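(* Let $D\subseteq\mathbb{R}^2$ be a bounded Borel set equipped with a finite diffuse Borel measure $\mu$ with $\mu(D)>0$, and let $M$ be a complete separable metric space equipped with a Borel probability measure $\mu_M$. Let $N^f=\bigcup_{n=0}^\infty (D\times M)^n$ be the space of finite sequences $\vec{y}=(y_1,\dots,y_n)$ of marked points $y_i\in D\times M$, and let $f:N^f\to[0,\infty)$ be a probability density with respect to the reference measure $\nu$ on $N^f$ given by $$\nu(F)=\sum_{n=0}^\infty \frac{e^{-\mu(D)}}{n!}\int_{D\times M}\cdots\int_{D\times M}\mathbf{1}\{(y_1,\dots,y_n)\in F\}\,d(\mu\times\mu_M)(y_1)\cdots d(\mu\times\mu_M)(y_n).$$ Let $\sim$ be a reflexive (not necessarily symmetric) relation on $D\times M$. Then the sequential spatial process with density $f$ is Markov with respect to $\sim$ (in the sense defined in the context) if and only if there exists a non-negative, jointly measurable function $\varphi:(D\times M)\times\widetilde{N}^f\to[0,\infty)$ such that $\varphi(u,\mathbf{z})=1$ whenever $\mathbf{z}$ is not a $u$-clique, and such that for every $n\ge 0$ and every $(y_1,\dots,y_n)\in(D\times M)^n$, $$f(y_1,\dots,y_n)=f(\emptyset)\prod_{i=1}^n\prod_{\mathbf{z}\subseteq\mathbf{y}_{<i}}\varphi(y_i,\mathbf{z}),$$ where $\mathbf{y}_{<i}=\{y_1,\dots,y_{i-1}\}$ and the inner product ranges over all subsets $\mathbf{z}$ of $\mathbf{y}_{<i}$ (including the empty set).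
   Context: $\widetilde{N}^f$ denotes the family of finite unordered configurations (finite sets) of marked points in $D\times M$; a sequence is identified with the set of its components when permutation-invariance applies. $\emptyset$ denotes the empty sequence. A subsequence of $\vec{y}$ is a sequence obtained from $\vec{y}$ by deleting some of its components while keeping the order of the rest. For $u\in D\times M$, $(\vec{y},u)=(y_1,\dots,y_n,u)$ denotes appending $u$ at the end. If $u\sim y$, the marked point $y$ is called a directed neighbour of $u$. The density $f$ is called Markov with respect to $\sim$ if (i) $f(\vec{y})>0$ implies $f(\vec{z})>0$ for all subsequences $\vec{z}$ of $\vec{y}$, and (ii) for all $\vec{y}$ with $f(\vec{y})>0$ and all $u\in D\times M$, the ratio $f((\vec{y},u))/f(\vec{y})$ depends only on $u$ and on the set of its directed neighbours $\{y_i\in\vec{y}: u\sim y_i\}$ in $\vec{y}$. For $u\in D\times M$, a finite configuration $\mathbf{z}$ is a $u$-clique with respect to $\sim$ if either $\mathbf{z}=\emptyset$ or $u\sim z$ for every $z\in\mathbf{z}$. *)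

(* Defs.v *)
From HB Require Import structures.
From mathcomp Require Import all_boot all_order all_algebra.
From mathcomp Require Import all_classical all_reals all_analysis.
From mathcomp Require Import finmap.

Set Implicit Arguments.
Unset Strict Implicit.
Unset Printing Implicit Defensive.

Import Order.TTheory GRing.Theory Num.Theory.
Local Open Scope classical_set_scope.
Local Open Scope ring_scope.

Section SeqSpatial.
Context (R : realType) (M : completePseudoMetricType R).

Definition MB : measurableType _ := g_sigma_algebraType (@open M).

Definition X := ((R * R)%type * MB)%type.

Fixpoint rect (As : seq (set X)) : set (seq X) :=
  match As with
  | [::] => [set s | s = [::]]
  | A :: As' => [set s | match s with
                         | [::] => False
                         | x :: s' => A x /\ rect As' s'
                         end]
  end.

Definition rects : set (set (seq X)) :=
  [set S | exists As : seq (set X),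
      (forall i, measurable (nth setT As i)) /\ S = rect As].

(* N^f = disjoint union of the (R^2 x M)^n with the disjoint-union-of-products
   sigma-algebra (generated by the measurable rectangles of every length). *)
Definition seqX := seq X.
HB.instance Definition _ := Choice.on seqX.
HB.instance Definition _ := isPointed.Build seqX [::].
Definition NfX : measurableType _ := g_sigma_algebraType (rects : set (set seqX)).

Definition inDM (D : set (R * R)) : set X := [set u | D u.1].
Definition inND (D : set (R * R)) : set NfX :=
  [set s | forall x, x \in s -> inDM D x].

Fixpoint iterint (m : set X -> \bar R) (D : set (R * R)) (n : nat)
  (g : seq X -> \bar R) : \bar R :=
  match n with
  | 0 => g [::]
  | n'.+1 => (\int[m]_(x in inDM D) iterint m D n' (fun s => g (x :: s)))%E
  end.

Definition nbrs (rel : X -> X -> Prop) (u : X) (y : seq X) : set X :=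
  [set x | x \in y /\ rel u x].

Definition seq_markov (D : set (R * R)) (rel : X -> X -> Prop) (f : seq X -> R) :=
  (forall y z : seq X, inND D y -> 0 < f y -> subseq z y -> 0 < f z) /\
  (forall (y y' : seq X) (u : X), inND D y -> inND D y' -> inDM D u ->
     0 < f y -> 0 < f y' -> nbrs rel u y = nbrs rel u y' ->
     f (rcons y u) / f y = f (rcons y' u) / f y').

Definition clique (rel : X -> X -> Prop) (u : X) (z : {fset X}) :=
  z = fset0 \/ (forall x, x \in z -> rel u x).

End SeqSpatial.

(* Main.v *)
(* Write lambda(u, y) = f(y, u) / f(y).  If f is Markov, this ratio does not
   depend on the order of y, so that for any ordering with positive density it
   equals the ratio of the sums of f(y, u) and f(y) over all orderings y of a
   set z; the function lambda(u, z) so defined does not mention the relation,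
   which need not be measurable.  The interaction phi(u, z) is the
   multiplicative Moebius transform of lambda(u, .) as long as all proper
   subsets of z have a nonzero ratio, and 1 otherwise.  The minimal zeros of
   lambda(u, .) then have phi = 0, which makes the product over the subsets of z
   vanish whenever lambda(u, z) = 0, and Moebius inversion handles the other
   case.  If z contains a point x that is not a neighbour of u, then adding x to
   a subset does not change lambda, and the factors of phi(u, z) cancel in
   pairs.  Conversely, in a product of interactions only the subsets of the set
   of neighbours contribute to the ratio, and the factors of a subsequence are
   among those of the sequence. *)
Require Import Defs.
From HB Require Import structures.
From mathcomp Require Import all_boot all_order all_algebra.
From mathcomp Require Import all_classical all_reals all_analysis.
From mathcomp Require Import finmap measurable_realfun.

Set Implicit Arguments.
Unset Strict Implicit.
Unset Printing Implicit Defensive.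

Import Order.TTheory GRing.Theory Num.Theory.
Local Open Scope classical_set_scope.
Local Open Scope ring_scope.

(** * Products over power sets and multiplicative Moebius inversion *)

Lemma prod_fpowersetU1 (R : comNzRingType) (T : choiceType) (H : {fset T} -> R)
    (x : T) (z : {fset T}) :
  x \notin z ->
  \prod_(w <- fpowerset (x |` z)%fset) H w =
  (\prod_(w <- fpowerset z) H w) * \prod_(w <- fpowerset z) H (x |` w)%fset.
Proof.
move=> xz; rewrite -(big_map (fun w => (x |` w)%fset) xpredT H) -big_cat /=.
have notin w : w \in fpowerset z -> x \notin w.
  by rewrite fpowersetE => /fsubsetP wz; apply: contra xz; exact: wz.
apply: perm_big; apply: uniq_perm; first exact: fset_uniq.
  rewrite cat_uniq fset_uniq /= map_inj_in_uniq ?fset_uniq ?andbT; last first.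
    by move=> v w /notin xv /notin xw e; rewrite -(fsetU1K xv) e fsetU1K.
  by apply/hasPn => _ /mapP[w _ ->]; apply/negP => /notin; rewrite fset1U1.
move=> w; rewrite mem_cat fpowersetE; apply/idP/orP => [wz|[]].
- have [xw|xw] := boolP (x \in w).
    right; apply/mapP; exists (w `\ x)%fset; last by rewrite fsetD1K.
    by rewrite fpowersetE fsubDset.
  left; rewrite fpowersetE; apply/fsubsetP => y yw.
  have /fset1UP[e|//] := fsubsetP wz _ yw; by rewrite -e yw in xw.
- by rewrite fpowersetE => /fsubset_trans -> //; rewrite fsubsetUr.
- by case/mapP => v; rewrite fpowersetE => vz ->; rewrite fsetUS.
Qed.

Lemma prod_fpowerset_imfset (R : comNzRingType) (S T : choiceType) (g : S -> T)
    (I : {fset S}) (H : {fset T} -> R) : {in I &, injective g} ->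
  \prod_(w <- fpowerset [fset g i | i in I]%fset) H w =
  \prod_(J <- fpowerset I) H [fset g i | i in J]%fset.
Proof.
move=> ginj; rewrite -(big_map (fun J : {fset S} => [fset g i | i in J]%fset) xpredT H) /=.
apply: perm_big; apply: uniq_perm; first exact: fset_uniq.
  rewrite map_inj_in_uniq ?fset_uniq // => J K; rewrite !fpowersetE => JI KI e.
  have sub A B : (A `<=` I)%fset -> (B `<=` I)%fset ->
      [fset g i | i in A]%fset = [fset g i | i in B]%fset -> (A `<=` B)%fset.
    move=> AI BI AB; apply/fsubsetP => i iA.
    have : g i \in [fset g i | i in A]%fset by apply/imfsetP; exists i.
    rewrite AB => /imfsetP[j /= jB gij].
    by rewrite (ginj _ _ (fsubsetP AI _ iA) (fsubsetP BI _ jB) gij).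
  by apply/eqP; rewrite eqEfsubset (sub _ _ JI KI e) (sub _ _ KI JI (esym e)).
move=> w; rewrite fpowersetE; apply/idP/mapP => [wI|[J]].
  exists [fset i in I | g i \in w]%fset.
    by rewrite fpowersetE; apply/fsubsetP => i; rewrite !inE => /andP[].
  apply/fsetP => y; apply/idP/imfsetP => /= [yw|[i]].
    have /imfsetP[i /= iI yi] := fsubsetP wI _ yw.
    by exists i => //; rewrite !inE iI -yi.
  by rewrite !inE => /andP[_ iw] ->.
rewrite fpowersetE => JI ->; apply/fsubsetP => _ /imfsetP[i /= iJ ->].
by apply/imfsetP; exists i => //; exact: (fsubsetP JI).
Qed.

(** Multiplicative Moebius transform: the exponent of [l w] is $(-1)^{|z|-|w|}$, since the sum of
    the two cardinals has the parity of their difference. *)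
Definition mobius {R : fieldType} {T : choiceType} (l : {fset T} -> R)
    (z : {fset T}) : R :=
  \prod_(w <- fpowerset z)
     (if odd (#|` z| + #|` w|) then (l w)^-1 else l w).

(** Induction on [z] for all [l] at once. The transform of [l] at a subset with [x] added is the
    transform of the quotient [l'] at the subset, so the subsets without [x] contribute [l z] and
    those with [x] contribute [l' z]. *)
Lemma prod_mobius (R : fieldType) (T : choiceType) (l : {fset T} -> R)
    (z : {fset T}) : (forall w, (w `<=` z)%fset -> l w != 0) ->
  \prod_(w <- fpowerset z) mobius l w = l z.
Proof.
elim/fset1U_rect: z l => [|x z xz IH] l l0.
  by rewrite fpowerset0 big_seq_fset1 /mobius fpowerset0 big_seq_fset1 cardfs0.
have l0z w : (w `<=` z)%fset -> l w != 0.
  by move=> wz; apply/l0/(fsubset_trans wz); rewrite fsubsetUr.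
have l0x w : (w `<=` z)%fset -> l (x |` w)%fset != 0.
  by move=> wz; apply/l0/fsetUS.
rewrite prod_fpowersetU1 // IH //.
pose l' w := l (x |` w)%fset / l w.
have l'0 w : (w `<=` z)%fset -> l' w != 0.
  by move=> wz; rewrite mulf_neq0 ?invr_neq0 //; [exact: l0x|exact: l0z].
rewrite (eq_big_seq (mobius l')) ?IH //.
  by rewrite /l' mulrCA divff ?mulr1 // l0z.
move=> w; rewrite fpowersetE => wz.
have notin v : (v `<=` z)%fset -> x \notin v.
  by move=> /fsubsetP vz; apply: contra xz; exact: vz.
rewrite /mobius prod_fpowersetU1 ?notin // -big_split /=.
apply: eq_big_seq => v; rewrite fpowersetE => vw.
rewrite !cardfsU1 !notin // ?(fsubset_trans vw) //= !addSn addnS /= negbK.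
by case: odd => /=; rewrite ?invfM ?invrK // mulrC.
Qed.

(** The subsets [w] with and without [x] carry equal values with opposite exponents. *)
Lemma mobius_eq1 (R : fieldType) (T : choiceType) (l : {fset T} -> R)
    (x : T) (z : {fset T}) : x \notin z ->
  (forall w, (w `<=` z)%fset -> l w != 0) ->
  (forall w, (w `<=` z)%fset -> l (x |` w)%fset = l w) ->
  mobius l (x |` z)%fset = 1.
Proof.
move=> xz l0 lx; rewrite /mobius prod_fpowersetU1 // -big_split big_seq big1 //=.
move=> w; rewrite fpowersetE => wz; rewrite lx //.
have xw : x \notin w by apply: contra xz; exact: (fsubsetP wz).
rewrite !cardfsU1 xz xw /= !addSn addnS /= negbK.
by case: odd => /=; rewrite ?mulVf ?mulfV ?l0.
Qed.

(** * Sums over orderings and the interaction *)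

Lemma perm_map_ex (S T : eqType) (g : S -> T) (s : seq S) (t : seq T) :
  perm_eq t (map g s) -> exists2 r, perm_eq r s & t = map g r.
Proof.
case: s => [/perm_nilP ->|i s]; first by exists [::].
case/(perm_iotaP (g i)) => Is Isp ->.
exists (map (nth i (i :: s)) Is).
  by apply/(perm_iotaP i); exists Is => //; rewrite -(size_map g).
rewrite -map_comp; apply/eq_in_map => j; rewrite (perm_mem Isp) mem_iota size_map.
by move=> jI; rewrite (nth_map i).
Qed.

Definition perm_sum {R : fieldType} {T : choiceType} (h : seq T -> R)
    (z : {fset T}) : R := \sum_(y <- permutations z) h y.

Definition perm_ratio {R : fieldType} {T : choiceType} (h k : seq T -> R)
    (z : {fset T}) : R := perm_sum k z / perm_sum h z.

(* Set to [1] unless [z] is admissible and all proper subsets have a nonzero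
   ratio. The subsets are compared through their cardinals, so that the formula
   only involves [h] and [k] through sums over permutations. *)
Definition interaction {R : fieldType} {T : choiceType} (h k : seq T -> R)
    (z : {fset T}) : R :=
  if perm_sum h z *
     (\prod_(w <- fpowerset z | (#|` w| < #|` z|)%N) perm_ratio h k w) == 0
  then 1 else mobius (perm_ratio h k) z.

(** By injectivity, [map g] is a bijection from the orderings of [I] to those of its image. *)
Lemma perm_sum_imfset (R : fieldType) (S T : choiceType) (g : S -> T)
    (I : {fset S}) (h : seq T -> R) : {in I &, injective g} ->
  perm_sum h [fset g i | i in I]%fset = perm_sum (h \o map g) I.
Proof.
move=> ginj; rewrite /perm_sum -(big_map (map g) xpredT h) /=.
have gI : perm_eq [fset g i | i in I]%fset (map g I) by exact: enum_imfset.
apply: perm_big; apply: uniq_perm; first exact: permutations_uniq.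
  rewrite map_inj_in_uniq ?permutations_uniq // => s t.
  rewrite !mem_permutations => sI tI.
  by apply: (inj_in_map ginj); apply/allP => i; rewrite (perm_mem sI, perm_mem tI).
move=> s; rewrite mem_permutations (permPr gI); apply/idP/mapP => [sI|[t]].
  have [t tI ->] := perm_map_ex sI; exists t => //.
  by rewrite mem_permutations.
by rewrite mem_permutations => tI ->; exact: perm_map.
Qed.

(** Replaces a configuration that varies with a parameter by a fixed set of indices; injectivity
    preserves the cardinals in the guard and in the exponents. *)
Lemma interaction_imfset (R : fieldType) (S T : choiceType) (g : S -> T)
    (I : {fset S}) (h k : seq T -> R) : {in I &, injective g} ->
  interaction h k [fset g i | i in I]%fset =
  interaction (h \o map g) (k \o map g) I.
Proof.
move=> ginj.
have gsub (J : {fset S}) : (J `<=` I)%fset -> {in J &, injective g}.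
  by move=> /fsubsetP JI i j iJ jJ; apply: ginj; exact: JI.
have card_g (J : {fset S}) : (J `<=` I)%fset -> #|` [fset g i | i in J]%fset| = #|` J|.
  by move=> JI; apply: card_in_imfset; exact: gsub.
have ratio_g (J : {fset S}) : (J `<=` I)%fset ->
    perm_ratio h k [fset g i | i in J]%fset =
    perm_ratio (h \o map g) (k \o map g) J.
  by move=> JI; rewrite /perm_ratio !perm_sum_imfset //; exact: gsub.
rewrite /interaction perm_sum_imfset //.
rewrite big_mkcond [in RHS]big_mkcond /mobius !prod_fpowerset_imfset //.
congr (if _ * _ == 0 then 1 else _); apply: eq_big_seq => J;
  by rewrite fpowersetE => JI; rewrite ratio_g // !card_g.
Qed.

(** The factors of the points of [y] only see prefixes of [y], which appending [u] leaves
    unchanged. *)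
Lemma prod_take_rcons (R : comNzRingType) (T : choiceType)
    (phi : T -> {fset T} -> R) (y : seq T) (u : T) :
  \prod_(i < size (rcons y u))
     \prod_(z <- fpowerset [fset x | x in take i (rcons y u)]%fset)
        phi (tnth (in_tuple (rcons y u)) i) z =
  (\prod_(i < size y)
     \prod_(z <- fpowerset [fset x | x in take i y]%fset)
        phi (tnth (in_tuple y) i) z) *
  \prod_(z <- fpowerset [fset x | x in y]%fset) phi u z.
Proof.
under [LHS]eq_bigr do rewrite (tnth_nth u) /=.
rewrite size_rcons big_ord_recr /= nth_rcons ltnn eqxx -cats1 take_size_cat // cats1.
congr (_ * _); apply: eq_bigr => i _.
by rewrite (tnth_nth u) nth_rcons ltn_ord -cats1 takel_cat // ltnW.
Qed.

(** * The Markov property and the product form *)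

Section Factorization.
Context (R : realType) (M : completePseudoMetricType R) (D : set (R * R)).
Context (rel : X M -> X M -> Prop) (f : seq (X M) -> R).

Lemma inND_sub (y z : seq (X M)) :
  {subset z <= y} -> inND D y -> inND D z.
Proof. by move=> zy yD x /zy; exact: yD. Qed.

Lemma inND_rcons (y : seq (X M)) (u : X M) :
  inND D y -> inDM D u -> inND D (rcons y u).
Proof. by move=> yD uD x; rewrite mem_rcons inE => /orP[/eqP ->|/yD]. Qed.

Hypothesis f_ge0 : forall s, inND D s -> 0 <= f s.

(** * From the Markov property to the product form *)

Section Forward.
Hypothesis markov : seq_markov D rel f.

Let phi (u : X M) := interaction f (fun y => f (rcons y u)).
Let ratio (u : X M) := perm_ratio f (fun y => f (rcons y u)).

Lemma markov_subseq (y z : seq (X M)) :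
  inND D y -> 0 < f y -> subseq z y -> 0 < f z.
Proof. exact: markov.1. Qed.

Lemma markov_rcons_eq0 (y : seq (X M)) (u : X M) :
  inND D y -> inDM D u -> f y = 0 -> f (rcons y u) = 0.
Proof.
move=> yD uD fy; have yuD := inND_rcons yD uD.
apply/eqP; apply: contraTT isT => fyu.
have : 0 < f y.
  by apply: (markov_subseq yuD); [rewrite lt0r fyu f_ge0|exact: subseq_rcons].
by rewrite fy ltxx.
Qed.

(** The sequence [y] may have repetitions, but [undup y] is a subsequence of it and an ordering of
    [z]; its positive term is not cancelled by the other, nonnegative ones. *)
Lemma perm_sum_neq0 (y : seq (X M)) (z : {fset X M}) :
  inND D y -> 0 < f y -> y =i z -> perm_sum f z != 0.
Proof.
move=> yD fy yz; have yp : undup y \in permutations z.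
  rewrite mem_permutations; apply: uniq_perm; rewrite ?undup_uniq ?fset_uniq //.
  by move=> x; rewrite mem_undup yz.
have fu : 0 < f (undup y) by apply: (markov_subseq yD fy); exact: undup_subseq.
rewrite /perm_sum (perm_big _ (perm_to_rem yp)) big_cons /= gt_eqF //.
rewrite ltr_wpDr // big_seq sumr_ge0 // => s /mem_rem.
rewrite mem_permutations => /perm_mem sz; apply: f_ge0; apply: inND_sub yD => x.
by rewrite sz yz.
Qed.

Lemma perm_sum_neq0_ex (z : {fset X M}) : inND D z ->
  perm_sum f z != 0 -> exists2 y, y =i z & 0 < f y.
Proof.
move=> zD fz; apply: contrapT => no.
move: fz; rewrite /perm_sum big_seq big1 ?eqxx // => s.
rewrite mem_permutations => /perm_mem sz.
apply/eqP; apply: contraTT isT => fs; exfalso; apply: no; exists s => //.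
by rewrite lt0r fs f_ge0 //; apply: inND_sub zD => x; rewrite sz.
Qed.

(** All orderings [s] of [z] give [u] the same neighbours as [y], so [f (rcons s u)] is the same
    multiple of [f s] for each of them; where [f s = 0], both terms vanish. Summation gives the
    ratio. *)
Lemma ratioE (u : X M) (y : seq (X M)) (z : {fset X M}) :
  inDM D u -> inND D y -> 0 < f y -> y =i z ->
  ratio u z = f (rcons y u) / f y.
Proof.
move=> uD yD fy yz; apply: (canLR (mulfK (perm_sum_neq0 yD fy yz))).
rewrite /perm_sum big_distrr /=; apply: eq_big_seq => s.
rewrite mem_permutations => /perm_mem sz.
have sy : s =i y by move=> x; rewrite sz yz.
have sD : inND D s by apply: inND_sub yD => x; rewrite sy.
have [fs|fs] := eqVneq (f s) 0; first by rewrite fs mulr0 markov_rcons_eq0.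
have fs0 : 0 < f s by rewrite lt0r fs f_ge0.
rewrite (markov.2 y s u) ?divfK //.
by apply/seteqP; split => x [xy ?]; split; rewrite // ?sy // -sy.
Qed.

(** Restricting an ordering of [z] of positive density to [w] gives a subsequence. *)
Lemma perm_sum_sub_neq0 (z w : {fset X M}) : inND D z ->
  perm_sum f z != 0 -> (w `<=` z)%fset -> perm_sum f w != 0.
Proof.
move=> zD /(perm_sum_neq0_ex zD)[y yz fy] /fsubsetP wz.
have yD : inND D y by apply: inND_sub zD => x; rewrite yz.
have sub : subseq [seq x <- y | x \in w] y by exact: filter_subseq.
apply: (perm_sum_neq0 _ (markov_subseq yD fy sub)).
  by apply: inND_sub yD; exact: mem_subseq.
by move=> x; rewrite mem_filter yz; apply/andb_idr/wz.
Qed.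

Lemma ratio_sub_neq0 (u : X M) (z w : {fset X M}) : inDM D u -> inND D z ->
  perm_sum f z != 0 -> ratio u z != 0 -> (w `<=` z)%fset -> ratio u w != 0.
Proof.
move=> uD zD /(perm_sum_neq0_ex zD)[y yz fy] rz /fsubsetP wz.
have yD : inND D y by apply: inND_sub zD => x; rewrite yz.
have yuD := inND_rcons yD uD.
have fyu : 0 < f (rcons y u).
  rewrite lt0r f_ge0 // andbT; apply: contraNneq rz => fyu.
  by rewrite (ratioE uD yD fy yz) fyu mul0r.
set v := [seq x <- y | x \in w].
have sub : subseq v y by exact: filter_subseq.
have vD : inND D v by apply: inND_sub yD; exact: mem_subseq.
have fv := markov_subseq yD fy sub.
rewrite (@ratioE u v) // => [|x].
  rewrite mulf_neq0 ?invr_neq0 // gt_eqF //.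
  by apply: (markov_subseq yuD fyu); rewrite -!cats1 cat_subseq.
by rewrite mem_filter yz; apply/andb_idr/wz.
Qed.

(** Deleting the non-neighbour [x] from an ordering of positive density does not change the
    neighbours of [u]. *)
Lemma ratio_notin (u x : X M) (z : {fset X M}) : inDM D u ->
  inND D (x |` z)%fset -> perm_sum f (x |` z)%fset != 0 -> x \notin z ->
  ~ rel u x -> ratio u (x |` z)%fset = ratio u z.
Proof.
move=> uD zD /(perm_sum_neq0_ex zD)[y yz fy] xz ux.
have yD : inND D y by apply: inND_sub zD => t; rewrite yz.
set v := [seq t <- y | t != x].
have sub : subseq v y by exact: filter_subseq.
have vD : inND D v by apply: inND_sub yD; exact: mem_subseq.
have fv := markov_subseq yD fy sub.
have vz : v =i z.
  move=> t; rewrite mem_filter yz in_fset1U; case: eqVneq => //= ->.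
  by rewrite (negbTE xz).
rewrite (ratioE uD yD fy yz) (ratioE uD vD fv vz); apply: markov.2 => //.
apply/seteqP; split => t [ty ut]; split => //.
  by rewrite mem_filter ty andbT; apply/eqP => e; apply: ux; rewrite -e.
by move: ty; rewrite mem_filter => /andP[].
Qed.

Lemma interaction_ge0 (u : X M) (z : {fset X M}) : inDM D u -> inND D z ->
  0 <= phi u z.
Proof.
move=> uD zD; rewrite /phi /interaction; case: ifP => // _.
have ratio_ge0 w : (w `<=` z)%fset -> 0 <= ratio u w.
  move=> /fsubsetP wz.
  have wD s : s \in permutations w -> inND D s.
    by rewrite mem_permutations => /perm_mem sw; apply: inND_sub zD => x;
      rewrite sw; exact: wz.
  rewrite /ratio /perm_ratio /perm_sum divr_ge0 // big_seq sumr_ge0 // => s /wD sD.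
    by apply/f_ge0/inND_rcons.
  exact: f_ge0.
rewrite /mobius big_seq prodr_ge0 // => w; rewrite fpowersetE => /ratio_ge0 w0.
by case: ifP => // _; rewrite invr_ge0.
Qed.

Lemma proper_ratio_neq0 (u : X M) (z w : {fset X M}) :
  \prod_(v <- fpowerset z | (#|` v| < #|` z|)%N) ratio u v != 0 ->
  (w `<` z)%fset -> ratio u w != 0.
Proof.
rewrite prodf_seq_neq0 => /allP nz wz.
have := nz w; rewrite fpowersetE (fproper_sub wz) (fproper_ltn_card wz).
by move=> /(_ isT).
Qed.

(** Unless the guard already gives 1, choose a non-neighbour [x] in [z]: the subsets of [z] without
    [x] are proper, so their ratios are nonzero, and adding [x] does not change them. *)
Lemma interaction_not_clique (u : X M) (z : {fset X M}) : inDM D u ->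
  inND D z -> ~ clique rel u z -> phi u z = 1.
Proof.
move=> uD zD ncl; rewrite /phi /interaction.
case: ifPn => // /[!(mulf_eq0, negb_or)] /andP[fz nz].
have [x xz ux] : exists2 x, x \in z & ~ rel u x.
  apply: contrapT => no; apply: ncl; right => x xz.
  by apply: contrapT => ux; apply: no; exists x.
have zE := fsetD1K xz.
have sub_proper w : (w `<=` z `\ x)%fset -> (w `<` z)%fset.
  by move=> wz; apply: fsub_proper_trans wz _; exact: fproperD1.
rewrite -zE; apply: mobius_eq1; rewrite ?in_fsetD1 ?eqxx // => w wz.
  by apply: proper_ratio_neq0 nz _; exact: sub_proper.
have xw : x \notin w by apply/negP => /(fsubsetP wz); rewrite in_fsetD1 eqxx.
have xwz : (x |` w `<=` z)%fset by rewrite -zE fsetUS.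
apply: ratio_notin => //.
  by apply: inND_sub zD; exact/fsubsetP.
exact: perm_sum_sub_neq0 fz xwz.
Qed.

(** Strong induction on the cardinal of [z], since a vanishing ratio at [z] may be caused by a
    smaller subset. *)
Lemma prod_interaction (u : X M) (z : {fset X M}) : inDM D u ->
  inND D z -> perm_sum f z != 0 ->
  \prod_(w <- fpowerset z) phi u w = ratio u z.
Proof.
move=> uD; have [n] := ubnP #|` z|; elim: n z => // n IH z zn zD fz.
have wD w : (w `<=` z)%fset -> inND D w.
  by move=> wz; apply: inND_sub zD; exact/fsubsetP.
have fw w : (w `<=` z)%fset -> perm_sum f w != 0.
  exact: perm_sum_sub_neq0.
have phiE w : (w `<=` z)%fset -> (forall v, (v `<` w)%fset -> ratio u v != 0) ->
    phi u w = mobius (ratio u) w.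
  move=> wz nz; rewrite /phi /interaction ifF //; apply/negbTE.
  rewrite mulf_neq0 ?fw // prodf_seq_neq0; apply/allP => v.
  rewrite fpowersetE => vw; apply/implyP => card_v; apply: nz.
  by rewrite fproperEcard vw.
(* A nonzero ratio at [z] passes to all its subsets, so Moebius inversion applies. *)
have [rz|rz] := eqVneq (ratio u z) 0; last first.
  rewrite (eq_big_seq (mobius (ratio u))); last first.
    move=> w; rewrite fpowersetE => wz; apply: phiE => // v /fproper_sub vw.
    by apply: (ratio_sub_neq0 uD zD fz rz); exact: fsubset_trans vw wz.
  by rewrite prod_mobius // => w; exact: (ratio_sub_neq0 uD zD fz rz).
rewrite rz; apply/eqP; rewrite prodf_seq_eq0; apply/hasP => /=.
(* Either a proper subset [w] already has ratio 0, and a vanishing factor for [w] is also one for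
   [z], or [z] is a minimal zero. *)
have [[w wz rw]|no] := pselect (exists2 w, (w `<` z)%fset & ratio u w = 0).
  have wz' := fproper_sub wz.
  have := IH w _ (wD _ wz') (fw _ wz').
  rewrite rw => /(_ (leq_trans (fproper_ltn_card wz) zn)) /eqP.
  rewrite prodf_seq_eq0 => /hasP[v]; rewrite fpowersetE => vw /= v0.
  by exists v => //; rewrite fpowersetE (fsubset_trans vw).
exists z; first by rewrite fpowersetE.
rewrite phiE // => [|v vz]; last first.
  by apply/eqP => rv; apply: no; exists v.
(* The set [z] itself enters its transform with exponent $+1$, so the zero ratio appears
   uninverted. *)
rewrite /mobius (big_fsetD1 z) ?fpowersetE //= addnn odd_double rz mul0r.
by rewrite eqxx.
Qed.

(** Points are appended one at a time: each contributes the ratio of the densities after and before,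
    and once the density is 0 it stays 0. *)
Lemma interaction_factorization (y : seq (X M)) : inND D y ->
  f y = f [::] * \prod_(i < size y)
          \prod_(z <- fpowerset [fset x | x in take i y]%fset)
            phi (tnth (in_tuple y) i) z.
Proof.
elim/last_ind: y => [|y u IH] yuD; first by rewrite big_ord0 mulr1.
have yD : inND D y by apply: inND_sub yuD => x; rewrite mem_rcons inE orbC => ->.
have uD : inDM D u by apply: yuD; rewrite mem_rcons inE eqxx.
rewrite prod_take_rcons mulrA -IH //; have [fy|fy] := eqVneq (f y) 0.
  by rewrite fy mul0r markov_rcons_eq0.
have fy0 : 0 < f y by rewrite lt0r fy f_ge0.
have yz : y =i [fset x | x in y]%fset by move=> x; rewrite !inE.
rewrite prod_interaction //.
- by rewrite (ratioE uD yD fy0 yz) mulrC divfK.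
- by apply: inND_sub yD => x; rewrite -yz.
- exact: perm_sum_neq0 yD fy0 yz.
Qed.

End Forward.

(** * From the product form to the Markov property *)

Section Backward.
Context (phi : X M -> {fset X M} -> R).
Hypothesis phi_ge0 : forall u (z : {fset X M}), inDM D u -> inND D z -> 0 <= phi u z.
Hypothesis phi_not_clique : forall u (z : {fset X M}), inDM D u -> inND D z ->
  ~ clique rel u z -> phi u z = 1.
Hypothesis fE : forall y : seq (X M), inND D y ->
  f y = f [::] * \prod_(i < size y)
          \prod_(z <- fpowerset [fset x | x in take i y]%fset)
            phi (tnth (in_tuple y) i) z.

Lemma factorization_rcons (y : seq (X M)) (u : X M) :
  inND D y -> inDM D u ->
  f (rcons y u) = f y * \prod_(z <- fpowerset [fset x | x in y]%fset) phi u z.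
Proof.
move=> yD uD; rewrite fE; last exact: inND_rcons.
rewrite (fE yD) -mulrA; congr (_ * _).
exact: prod_take_rcons.
Qed.

Lemma factorization_markov : seq_markov D rel f.
Proof.
split=> [y z|y y' u yD y'D uD fy fy' nyy'].
  elim/last_ind: y z => [|y u IH] z yuD fyu.
    by rewrite subseq0 => /eqP ->.
  have yD : inND D y by apply: inND_sub yuD => x; rewrite mem_rcons inE orbC => ->.
  have uD : inDM D u by apply: yuD; rewrite mem_rcons inE eqxx.
  move: fyu; rewrite factorization_rcons // => fyu.
  have fy : 0 < f y.
    by rewrite lt0r f_ge0 // andbT; apply: contraTneq fyu => ->; rewrite mul0r ltxx.
  move/subseqP => [m]; rewrite size_rcons => sm ->{z}.
  (* The last bit [b] of the mask tells whether [u] is kept; if not, the induction hypothesis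
     suffices. *)
  case/lastP: m sm => // m b; rewrite size_rcons => -[sm].
  rewrite -!cats1 mask_cat //=.
  have sub : subseq (mask m y) y by exact: mask_subseq.
  have := IH (mask m y) yD fy sub; case: b; rewrite ?cats0 // cats1 => fm.
  have mD : inND D (mask m y) by apply: inND_sub yD; exact: mem_subseq.
  rewrite factorization_rcons // mulr_gt0 // lt0r; apply/andP; split; last first.
    rewrite big_seq prodr_ge0 // => w; rewrite fpowersetE => /fsubsetP wm.
    by apply: phi_ge0 => //; apply: inND_sub mD => x /wm; rewrite !inE.
  have : \prod_(w <- fpowerset [fset x | x in y]%fset) phi u w != 0.
    by apply: contraTneq fyu => ->; rewrite mulr0 ltxx.
  (* The factors of [u] after thinning are among those for [y], whose product is nonzero. *)
  rewrite !prodf_seq_neq0 => /allP nz; apply/allP => w; rewrite fpowersetE => wm.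
  apply: nz; rewrite fpowersetE (fsubset_trans wm) //; apply/fsubsetP => x.
  by rewrite !inE => /mem_mask.
have nbrsE s : inND D s -> 0 < f s ->
    f (rcons s u) / f s =
    \prod_(w <- fpowerset [fset x in s | `[< rel u x >]]%fset) phi u w.
  move=> sD fs; rewrite factorization_rcons // mulrAC divff ?gt_eqF // mul1r.
  apply/esym/big_fset_incl; first by rewrite fpowersetS; apply/fsubsetP => x; rewrite !inE => /andP[].
  (* A subset with a point outside the neighbours of [u] is not a clique, so its factor is 1. *)
  move=> w; rewrite !fpowersetE => ws wn; apply: phi_not_clique => //.
    by apply: inND_sub sD => x /(fsubsetP ws); rewrite !inE.
  move=> cl; move/negP: wn; apply; apply/fsubsetP => x xw; rewrite !inE.
  have := fsubsetP ws _ xw; rewrite !inE => -> /=; apply/asboolP.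
  by case: cl => [w0|]; [rewrite w0 in xw|exact].
rewrite !nbrsE //; congr (\prod_(w <- fpowerset _) _).
apply/fsetP => x; rewrite !inE; apply/andP/andP => -[xs /asboolP ux].
  have : nbrs rel u y x by split.
  by rewrite nyy' => -[? ?]; split => //; exact/asboolP.
have : nbrs rel u y' x by split.
by rewrite -nyy' => -[? ?]; split => //; exact/asboolP.
Qed.

End Backward.
End Factorization.

(** * Measurability of the interaction over a fixed index set *)

Lemma measurable_fun_countable_bigcup (d d' : measure_display)
    (T : measurableType d) (U : measurableType d') (I : countType)
    (E : I -> set T) (g : T -> U) :
  (forall i, measurable (E i)) -> (forall i, measurable_fun (E i) g) ->
  measurable_fun (\bigcup_i E i) g.
Proof.
move=> mE mg _ Y mY; rewrite setI_bigcupl.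
by apply: countable_bigcupT_measurable => // i; exact: mg.
Qed.

(* [x^-1 = x * (x^2)^-1] also at [x = 0], and [powR] agrees with the inverse on
   nonnegative reals. *)
Lemma measurable_fun_invr (d : measure_display) (T : measurableType d)
    (R : realType) (D : set T) (g : T -> R) :
  measurable_fun D g -> measurable_fun D (fun t => (g t)^-1).
Proof.
move=> mg.
apply: (eq_measurable_fun (fun t => g t * (g t * g t) `^ (-1))).
  move=> t _; rewrite powR_inv1 -?expr2 ?sqr_ge0 // expr2.
  have [->|g0] := eqVneq (g t) 0; first by rewrite mul0r invr0.
  by rewrite invfM mulrA divff // mul1r.
apply: measurable_funM => //.
apply: (measurableT_comp (measurable_powR (-1))).
exact: measurable_funM.
Qed.

Section MeasurableInteraction.
Context (d : measure_display) (T : measurableType d) (R : realType).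
Context (Q : set T) (S : choiceType) (h k : T -> seq S -> R).
Hypothesis mQ : measurable Q.
Hypothesis mh : forall s, measurable_fun Q (h ^~ s).
Hypothesis mk : forall s, measurable_fun Q (k ^~ s).

Lemma measurable_perm_ratio (z : {fset S}) :
  measurable_fun Q (fun t => perm_ratio (h t) (k t) z).
Proof.
apply: measurable_funM.
  exact: measurable_sum.
by apply: measurable_fun_invr; exact: measurable_sum.
Qed.

Lemma measurable_interaction (z : {fset S}) :
  measurable_fun Q (fun t => interaction (h t) (k t) z).
Proof.
apply: measurable_fun_if => //.
- apply: measurable_fun_eqr => //.
  apply: measurable_funM.
    exact: measurable_sum.
  (* The cardinal condition does not depend on [t], so each factor is either a ratio or the constant
     1. *)
  under eq_fun do rewrite big_mkcond.
  apply: measurable_prod => w _.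
  by case: (_ < _)%N => //; exact: measurable_perm_ratio.
- apply: (measurable_funS mQ); first exact: subIsetl.
  apply: measurable_prod => w _; case: odd.
    by apply: measurable_fun_invr; exact: measurable_perm_ratio.
  exact: measurable_perm_ratio.
Qed.

End MeasurableInteraction.

(** Two marks differ exactly when, for some [n] and some point [s] of the countable dense set, the
    interior of the ball of radius $1/(n+1)$ around [s] contains [g t] but not [h t]. *)
Lemma measurable_eq_separable (R : realType) (M : completePseudoMetricType R)
    (d : measure_display) (T : measurableType d) (E : set T) (g h : T -> MB M) :
  hausdorff_space M -> (exists S : set M, countable S /\ dense S) ->
  measurable E -> measurable_fun E g -> measurable_fun E h ->
  measurable (E `&` [set t | g t = h t]).
Proof.
move=> hM [S [cS dS]] mE mg mh.
(* Interiors make the sets open, hence measurable. *)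
pose U (s : M) (n : nat) : set M := (ball s n.+1%:R^-1)^°.
have mU s n : measurable (U s n : set (MB M)).
  by apply: sub_sigma_algebra; exact: open_interior.
pose sep n := \bigcup_(s in S)
  ((E `&` g @^-1` U s n) `&` (E `&` h @^-1` ~` U s n)).
have msep n : measurable (sep n).
  rewrite /sep bigcup_set_type; apply: countable_bigcupT_measurable.
    by rewrite (eq_countable (card_setT S)).
  by move=> s; apply: measurableI; [exact: mg|apply: mh => //; exact: measurableC].
suff -> : E `&` [set t | g t = h t] = E `\` \bigcup_n sep n.
  by apply: measurableD => //; exact: bigcupT_measurable.
apply/seteqP; split => t [Et].
  by move=> /= gh; split => // -[n _ [s _ [[_ gU] [_]]]] /=; rewrite -gh.
move=> nsep; split => //=; apply: (close_eq hM); rewrite ball_close => e.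
have e2 : 0 < e%:num / 2 :> R by rewrite divr_gt0.
have [n _ /(_ n (leqnn n)) ne] := near_infty_natSinv_lt (PosNum e2).
(* With [s] within half the radius of [g t], a whole neighbourhood of [g t] lies in the ball around
   [s], so [g t] is in its interior. *)
have n2 : 0 < n.+1%:R^-1 / 2 :> R by rewrite divr_gt0 // invr_gt0.
have [s [Ss gs]] : (ball (g t : M) (n.+1%:R^-1 / 2))^° `&` S !=set0.
  apply: dS; last exact: open_interior.
  by exists (g t); exact: nbhsx_ballx.
have gU : U s n (g t).
  apply: filterS (nbhsx_ballx (g t : M) _ n2) => y gy.
  by apply: ball_splitr gy; exact: interior_subset.
have hU : U s n (h t).
  apply: contrapT => hU; apply: nsep; exists n => //; exists s => //.
have sub : ball s n.+1%:R^-1 `<=` ball s (e%:num / 2) by apply: le_ball; exact: ltW.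
by apply: (@ball_splitr _ _ s); apply: sub; exact: interior_subset.
Qed.

(** * Measurable maps into marked points and finite sequences *)

Section MeasurableSequences.
Context (R : realType) (M : completePseudoMetricType R).
Context (d : measure_display) (T : measurableType d) (E : set T).
Hypothesis mE : measurable E.

Lemma measurable_eq_mark (g h : T -> X M) :
  hausdorff_space M -> (exists S : set M, countable S /\ dense S) ->
  measurable_fun E g -> measurable_fun E h ->
  measurable (E `&` [set t | g t = h t]).
Proof.
move=> hM sM mg mh.
have m1 (g' : T -> X M) : measurable_fun E g' -> measurable_fun E (fst \o g').
  by move=> mg'; apply: measurableT_comp mg'; exact: measurable_fst.
have m2 (g' : T -> X M) : measurable_fun E g' -> measurable_fun E (snd \o g').
  by move=> mg'; apply: measurableT_comp mg'; exact: measurable_snd.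
have eqR (a b : T -> R) : measurable_fun E a -> measurable_fun E b ->
    measurable (E `&` [set t | a t = b t]).
  move=> ma mb; have := measurable_fun_eqr ma mb mE.
  move=> /(_ [set true] I); congr (measurable (_ `&` _)).
  by apply/seteqP; split => t /= /eqP.
have e1 : measurable (E `&` [set t | (g t).1.1 = (h t).1.1]).
  by apply: eqR; apply: (measurableT_comp measurable_fst); exact: m1.
have e2 : measurable (E `&` [set t | (g t).1.2 = (h t).1.2]).
  by apply: eqR; apply: (measurableT_comp measurable_snd); exact: m1.
have e3 := measurable_eq_separable hM sM mE (m2 _ mg) (m2 _ mh).
have := measurableI _ _ (measurableI _ _ e1 e2) e3; congr measurable.
apply/seteqP; split => t /=.
  by case: (g t) (h t) => [[? ?] ?] [[? ?] ?] /= [[[? ->] [_ ->]] [_ ->]].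
by move=> [Et ->].
Qed.

(** It suffices to test the generating rectangles: the one of length 0 has empty preimage, any other
    splits into conditions on head and tail. *)
Lemma measurable_fun_cons (g : T -> X M) (s : T -> NfX M) :
  measurable_fun E g -> measurable_fun E s ->
  measurable_fun E (fun t => (g t :: s t : NfX M)).
Proof.
move=> mg ms; apply: (@measurability _ _ _ (NfX M) _ _ (@rects R M)) => //.
move=> _ [_ [As [mA ->]] <-]; case: As mA => [|A As] mA.
  by rewrite (_ : _ `&` _ = set0) //; apply/seteqP; split => t // -[].
have mgA : measurable (E `&` g @^-1` A) by apply: mg => //; exact: (mA 0%N).
have msA : measurable (E `&` s @^-1` rect As).
  apply: ms => //; apply: sub_sigma_algebra; exists As; split => // i.
  exact: (mA i.+1).
have := measurableI _ _ mgA msA; congr measurable.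
by apply/seteqP; split => t /= => [[[Et ?] [_ ?]]|[Et [? ?]]].
Qed.

Lemma measurable_fun_map (J : Type) (g : J -> T -> X M) (s0 : T -> NfX M)
    (r : seq J) : (forall i, measurable_fun E (g i)) -> measurable_fun E s0 ->
  measurable_fun E (fun t => (map (g ^~ t) r ++ s0 t : NfX M)).
Proof.
by move=> mg ms0; elim: r => [//|i r IH] /=; exact: measurable_fun_cons.
Qed.

End MeasurableSequences.

(** * Sequences of fixed length and their coordinates *)

Section MeasurableSlices.
Context (R : realType) (M : completePseudoMetricType R).

Lemma rectP (As : seq (set (X M))) (x0 : X M) (s : seq (X M)) :
  rect As s <-> size s = size As /\
    forall i, (i < size As)%N -> nth setT As i (nth x0 s i).
Proof.
elim: As s => [|A As IH] [|x s] //=.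
- by split => [//|[]].
- by split => // -[].
- split => [[Ax /IH[-> sA]]|[[ss] sA]].
    by split => // -[|i] //=; exact: sA.
  split; first exact: (sA 0%N).
  by apply/IH; split => // i; exact: (sA i.+1).
Qed.

Lemma measurable_rect (As : seq (set (X M))) :
  (forall i, measurable (nth setT As i)) -> measurable (rect As : set (NfX M)).
Proof. by move=> mA; apply: sub_sigma_algebra; exists As. Qed.

Lemma measurable_inND (D : set (R * R)) :
  measurable D -> measurable (inND D : set (NfX M)).
Proof.
move=> mD; have mA : measurable (inDM D : set (X M)).
  by rewrite -[X in measurable X]setTI; exact: measurable_fst.
have -> : inND D = \bigcup_n (rect (nseq n (inDM D)) : set (NfX M)).
  apply/seteqP; split => [s sD|s [n _]].
    exists (size s) => //; elim: s sD => //= x s IH sD; split.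
      by apply: sD; rewrite mem_head.
    by apply: IH => y ys; apply: sD; rewrite inE ys orbT.
  elim: n s => [|n IH] [|x s] //= [xD /IH sD] y.
  by rewrite inE => /orP[/eqP ->|/sD].
apply: bigcupT_measurable => n; apply: measurable_rect => i.
by rewrite nth_nseq; case: ifP.
Qed.

(** Pairs of a point and a sequence of length [n]; the point also serves as the default of [nth]. *)
Definition slice (A : set (X M)) (n : nat) : set (X M * NfX M) :=
  A `*` rect (nseq n A).

Lemma sliceP (A : set (X M)) (n : nat) (p : X M * NfX M) :
  slice A n p <-> [/\ A p.1, size p.2 = n & forall x, x \in p.2 -> A x].
Proof.
case: p => u s; rewrite /slice /=; split => /=.
  case=> Au /(rectP _ u)[]; rewrite size_nseq => sn sA; split => // x.
  case/(nthP u) => i; rewrite sn => ilt <-.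
  by have := sA i ilt; rewrite nth_nseq ilt.
case=> Au sn sA; split => //; apply/(rectP _ u); rewrite size_nseq; split => // i ilt.
by rewrite nth_nseq ilt; apply: sA; rewrite mem_nth // sn.
Qed.

Lemma measurable_slice (A : set (X M)) (n : nat) :
  measurable A -> measurable (slice A n).
Proof.
move=> mA; apply: measurableX => //; apply: measurable_rect => i.
by rewrite nth_nseq; case: ifP.
Qed.

Lemma measurable_fun_nth (A : set (X M)) (n i : nat) : measurable A ->
  (i < n)%N -> measurable_fun (slice A n) (fun p => nth p.1 p.2 i).
Proof.
move=> mA ilt mS B mB.
(* The preimage of [B] is a rectangle constrained only at position [i]. *)
pose As := [seq if j == i then B else setT | j <- iota 0 n].
have mAs : measurable (rect As : set (NfX M)).
  apply: measurable_rect => j; have [jn|jn] := ltnP j n.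
    by rewrite (nth_map 0%N) ?size_iota //; case: ifP.
  by rewrite nth_default // size_map size_iota.
have := measurableI _ _ mS (measurableX measurableT mAs); congr measurable.
apply/seteqP; split => -[u s] [Sp].
  case=> _ /(rectP _ u)[_]; rewrite size_map size_iota => /(_ i ilt).
  by rewrite (nth_map 0%N) ?size_iota // nth_iota // eqxx; split.
have /sliceP[_ /= sn _] := Sp; move=> /= Bi; split => //; split => //.
apply/(rectP _ u); rewrite size_map size_iota; split => // j jn.
by rewrite (nth_map 0%N) ?size_iota // nth_iota // add0n; case: eqP => [->|].
Qed.

End MeasurableSlices.

(* A slice [size s = n] is cut along the pattern [e] of coincidences among the
   points of [s]; on each piece the underlying set is injectively indexed by a
   fixed set of first occurrences. *)
Lemma measurable_interaction_joint (R : realType)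
  (M : completePseudoMetricType R) (D : set (R * R)) (f : NfX M -> R) :
  hausdorff_space M -> (exists S : set M, countable S /\ dense S) ->
  measurable D -> measurable_fun (inND D) f ->
  measurable_fun (inDM D `*` inND D)
    (fun p : (X M * NfX M)%type =>
       interaction f (fun y => f (rcons y p.1)) [fset x | x in p.2]%fset).
Proof.
move=> hM sM mD mf; pose A : set (X M) := inDM D.
have mA : measurable A.
  by rewrite /A -[X in measurable X]setTI; exact: measurable_fst.
have mA' := @measurable_inND R M D mD.
have -> : inDM D `*` inND D = \bigcup_n slice A n.
  apply/seteqP; split => [[u s] [/= Au sA]|p [n _ /sliceP[? _ ?]] //].
  by exists (size s) => //; exact/sliceP.
apply: measurable_fun_countable_bigcup => n; first exact: measurable_slice.
have mS := measurable_slice n mA.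
pose x (i : 'I_n) (p : X M * NfX M) : X M := nth p.1 p.2 i.
have mx i : measurable_fun (slice A n) (x i).
  by apply: measurable_fun_nth.
(* There are finitely many patterns [e]; inconsistent ones give an empty piece. *)
pose Q (e : {ffun 'I_n * 'I_n -> bool}) := slice A n `&`
  \bigcap_(ij in [set: 'I_n * 'I_n])
     [set p | slice A n p /\ (x ij.1 p == x ij.2 p) = e ij].
have mQ e : measurable (Q e).
  apply: measurableI => //; apply: fin_bigcap_measurable => // ij _.
  have := measurable_eq_mark mS hM sM (mx ij.1) (mx ij.2).
  case: (e ij) => meq.
    move: meq; congr measurable; apply/seteqP; split => p /= [Sp].
      by move/eqP.
    by move/eqP.
  have := measurableD mS meq; congr measurable; apply/seteqP; split => p /= [Sp].
    by move=> ne; split => //; apply/eqP => xx; apply: ne.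
  by move/eqP => ne; split => // -[_ /ne].
have -> : slice A n = \bigcup_e Q e.
  apply/seteqP; split => [p Sp|p [e _ []] //].
  exists [ffun ij => x ij.1 p == x ij.2 p] => //; split => // ij _.
  by split => //; rewrite ffunE.
apply: measurable_fun_countable_bigcup => // e.
(* Positions whose point does not occur earlier, as read off from [e] alone. *)
pose I := [fset i : 'I_n | [forall j : 'I_n, (j < i)%N ==> ~~ e (j, i)]]%fset.
pose h (p : X M * NfX M) (r : seq 'I_n) := f (map (x ^~ p) r).
pose k (p : X M * NfX M) (r : seq 'I_n) := f (rcons (map (x ^~ p) r) p.1).
have mxQ i : measurable_fun (Q e) (x i).
  by apply: (measurable_funS mS) (mx i); exact: subIsetl.
have xA i p : slice A n p -> A (x i p).
  by case/sliceP => _ sn pA; apply: pA; rewrite mem_nth // sn.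
have mapA r p : Q e p -> forall y, y \in map (x ^~ p) r -> A y.
  by move=> [Sp _] _ /mapP[i _ ->]; exact: xA.
apply: (eq_measurable_fun (fun p => interaction (h p) (k p) I)).
  move=> p /set_mem[Sp Qp].
  have Se i j : (x i p == x j p) = e (i, j) by have [_ ->] := Qp (i, j) Logic.I.
  have -> : [fset y | y in p.2]%fset = [fset x i p | i in I]%fset.
    have /sliceP[_ sn _] := Sp.
    apply/fsetP => y; rewrite !inE; apply/idP/imfsetP => [yp|[i _ ->]]; last first.
      by rewrite mem_nth // sn.
    have idx : (index y p.2 < n)%N by rewrite -sn index_mem.
    exists (Ordinal idx) => /=; last by rewrite /x nth_index.
    rewrite !inE; apply/forallP => j; apply/implyP => /= jlt; rewrite -Se /x /=.
    by rewrite nth_index //; have := before_find p.1 jlt => /= ->.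
  (* If two such positions carried the same point, the larger would not be a first occurrence. *)
  rewrite interaction_imfset // => i j; rewrite !inE => /forallP iI /forallP jI.
  move=> /eqP xij; have [ij|ji|//] := ltngtP i j; last exact: val_inj.
    by have := jI i; rewrite ij -Se xij.
  by have := iI j; rewrite ji -Se eq_sym xij.
(* As [f] is measurable on [inND D], the composed sequences must be shown to stay there. *)
apply: measurable_interaction => // r; apply: (measurable_comp mA') mf _.
- by move=> _ [p Qp <-]; exact: (mapA _ _ Qp).
- have := @measurable_fun_map R M _ _ _ (mQ e) _ x (cst [::]) r mxQ.
  by under eq_fun do rewrite cats0; apply.
- move=> _ [p Qp <-] y; rewrite mem_rcons inE => /orP[/eqP ->|]; last exact: (mapA _ _ Qp).
  by case: Qp => /sliceP[].
- apply: (eq_measurable_fun (fun p => (map (x ^~ p) r ++ [:: p.1] : NfX M))).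
    by move=> p _; exact: cats1.
  apply: measurable_fun_map => //; apply: measurable_fun_cons => //.
  by apply: (measurable_funS measurableT); [|exact: measurable_fst].
Qed.

Theorem theorem1 (R : realType)
  (D : set (R * R)) (mD : measurable D)
  (bD : exists r : R, forall p, D p -> `|p.1| <= r /\ `|p.2| <= r)
  (mu : {measure set (R * R) -> \bar R})
  (mu_fin : (mu D < +oo)%E) (mu_pos : (0 < mu D)%E)
  (mu_diffuse : forall p, D p -> mu [set p] = 0%E)
  (M : completePseudoMetricType R) (M_hausdorff : hausdorff_space M)
  (M_separable : exists S : set M, countable S /\ dense S)
  (muM : probability (MB M) R)
  (rel : X M -> X M -> Prop) (rel_refl : forall u, inDM D u -> rel u u)
  (f : NfX M -> R)
  (f_ge0 : forall s, inND D s -> 0 <= f s)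
  (f_meas : measurable_fun (inND D) f)
  (f_dens : (\sum_(0 <= n <oo)
               ((expR (- fine (mu D)) / (n`!)%:R)%:E
                * iterint (mu \x muM)%E D n (fun s => (f s)%:E)))%E = 1%E) :
  seq_markov D rel f <->
  exists phi : X M -> {fset X M} -> R,
    measurable_fun (inDM D `*` inND D)
      (fun p : (X M * NfX M)%type => phi p.1 [fset x | x in p.2]%fset) /\
    (forall u z, inDM D u -> (forall x, x \in z -> inDM D x) -> 0 <= phi u z) /\
    (forall u z, inDM D u -> (forall x, x \in z -> inDM D x) ->
       ~ clique rel u z -> phi u z = 1) /\
    (forall y : seq (X M), inND D y ->
       f y = f [::] * \prod_(i < size y)
               \prod_(z <- fpowerset [fset x | x in take i y]%fset)
                  phi (tnth (in_tuple y) i) z).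
Proof.
split => [markov|[phi [_ [phi_ge0 [phi_clique fE]]]]]; last first.
  exact: (@factorization_markov R M D rel f f_ge0 phi phi_ge0 phi_clique fE).
exists (fun u => interaction f (fun y => f (rcons y u))).
split; [|split; [|split]].
- exact: measurable_interaction_joint.
- by move=> u z; exact: (interaction_ge0 f_ge0).
- by move=> u z; exact: (interaction_not_clique f_ge0 markov).
- exact: (interaction_factorization f_ge0 markov).
Qed.
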